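(* Let $d\ge1$, let $k\ge0$ be an integer, let $\mathcal{A} \subseteq \mathbb{S}^d \times [0,\infty)$ be a finite generic $k$-balanced set of weighted points, and let $\mathbf{a}=(a,r_a)\in\mathcal{A}$. Then the spherical $d$-simplices of $\mathcal{A}$ with heft $k$ cover $\mathbb{S}^d$ exactly $\binom{d+k}{d}$ times, i.e. every $x\in\mathbb{S}^d$ that does not lie on a common great $(d-1)$-sphere with $d$ locations of $\mathcal{A}$ lies in exactly $\binom{d+k}{d}$ such simplices; and the spherical $d$-simplices of $\mathcal{A}$ with heft at most $k$ having $a$ as a vertex cover every sufficiently small neighborhood of $a$ at most $\binom{d+k}{d}$ times.
   Context: $\mathbb{S}^d$ is the unit sphere in $\mathbb{R}^{d+1}$. A weighted point is $\mathbf{a}=(a,r_a)\in\mathbb{S}^d\times[0,\infty)$, identified with the point $r_a a\in\mathbb{R}^{d+1}$; $a$ is its location and $r_a^2-1$ its weight. A finite set $\mathcal{A}$ of weighted points is $k$-balanced if, on each side of every hyperplane of $\mathbb{R}^{d+1}$ through the origin, there are at least $k+1$ of the points $r_a a$. $\mathcal{A}$ is generic in the sense of general position: no $d+1$ locations are linearly dependent, and no $d+2$ of the points $r_a a$ lie on a common affine hyperplane of $\mathbb{R}^{d+1}$. The spherical $d$-simplex spanned by $d+1$ linearly independent locations is the central projection to $\mathbb{S}^d$ of their Euclidean convex hull. The spherical simplex spanned by the locations of $d+1$ weighted points of $\mathcal{A}$ has heft $k$ (is $k$-hefty) if the affine hyperplane of $\mathbb{R}^{d+1}$ through the corresponding $d+1$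 points $r_a a$ separates exactly $k$ of the remaining points $r_b b$, $\mathbf{b}\in\mathcal{A}$, from the origin $0\in\mathbb{R}^{d+1}$.
   Formalization: A simplex with a vertex of radius 0 (its hyperplane passes through the origin) is given no heft instead of heft 0, since otherwise the claim fails; sides of a hyperplane are open half-spaces, and distinct weighted points have distinct locations. *)

(* Defs.v *)
From HB Require Import structures.
From mathcomp Require Import all_boot all_order all_algebra.
From mathcomp Require Import finmap.
From mathcomp Require Import all_classical all_reals all_analysis.
Set Implicit Arguments.
Unset Strict Implicit.
Unset Printing Implicit Defensive.
Import Order.TTheory GRing.Theory Num.Theory.
Import numFieldNormedType.Exports.
Local Open Scope classical_set_scope.
Local Open Scope ring_scope.
Local Open Scope fset_scope.

Definition dot (R : realType) (n : nat) (u v : 'rV[R]_n) : R :=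
  \sum_i u 0 i * v 0 i.

(* The canonical norm of 'rV[R]_n is the sup norm, hence this definition. *)
Definition enorm (R : realType) (n : nat) (u : 'rV[R]_n) : R :=
  Num.sqrt (dot u u).

Definition sphere (R : realType) (d : nat) : set 'rV[R]_d.+1 :=
  [set x | enorm x = 1].
Arguments sphere : clear implicits.

(* A pair (a, r_a) of a location and a radius; membership in
   S^d x [0, +oo[ is imposed on sets of such pairs where needed. *)
Notation wpoint R d := ('rV[R]_d.+1 * R)%type.

Definition loc (R : realType) (d : nat) (p : wpoint R d) : 'rV[R]_d.+1 := p.1.

Definition pt (R : realType) (d : nat) (p : wpoint R d) : 'rV[R]_d.+1 :=
  p.2 *: p.1.

(* The affine hyperplane with normal u (u != 0) and offset c; it is linear,
   i.e. it passes through the origin, when c = 0. *)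
Definition hyperplane (R : realType) (n : nat) (u : 'rV[R]_n) (c : R) :
    set 'rV[R]_n :=
  [set x | dot u x = c].

Definition great_sphere (R : realType) (d : nat) (u : 'rV[R]_d.+1) :
    set 'rV[R]_d.+1 :=
  sphere R d `&` hyperplane u 0.

(* x and y lie in opposite open sides of hyperplane u c. *)
Definition separates (R : realType) (n : nat) (u : 'rV[R]_n) (c : R)
    (x y : 'rV[R]_n) : bool :=
  ((dot u x < c) && (c < dot u y)) || ((dot u y < c) && (c < dot u x)).

Definition generic (R : realType) (d : nat) (A : {fset wpoint R d}) : Prop :=
  (forall T : {fset wpoint R d}, T `<=` A -> #|` T| = d.+1 ->
     free [seq loc p | p <- T]) /\
  (forall T : {fset wpoint R d}, T `<=` A -> #|` T| = d.+2 ->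
     ~ exists u : 'rV[R]_d.+1, exists c : R,
         u != 0 /\ forall p, p \in T -> hyperplane u c (pt p)).

(* The two sides are the two open half-spaces. *)
Definition balanced (R : realType) (d k : nat) (A : {fset wpoint R d}) : Prop :=
  forall u : 'rV[R]_d.+1, u != 0 ->
    (k.+1 <= #|` [fset p in A | (0 < dot u (pt p))%R]|)%N /\
    (k.+1 <= #|` [fset p in A | (dot u (pt p) < 0)%R]|)%N.

(* For generic A with at least d + 2 points and T of cardinal d + 1, the
   hyperplane is unique, so at most one k satisfies has_heft A T k. The
   hyperplane passes through the origin only if T has a point of radius 0;
   in that case it separates no point from the origin in a meaningful sense,
   and T is given no heft at all (rather than heft 0). *)
Definition has_heft (R : realType) (d : nat) (A T : {fset wpoint R d})
    (k : nat) : Prop :=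
  exists u : 'rV[R]_d.+1, exists c : R,
    [/\ u != 0,
        forall p, p \in T -> hyperplane u c (pt p),
        ~ hyperplane u c 0
      & #|` [fset b in A `\` T | separates u c 0 (pt b)]| = k].

Definition convex_hull_loc (R : realType) (d : nat) (T : {fset wpoint R d}) :
    set 'rV[R]_d.+1 :=
  [set y | exists w : wpoint R d -> R,
     [/\ forall p, p \in T -> 0 <= w p,
         \sum_(p <- T) w p = 1
       & y = \sum_(p <- T) w p *: loc p]].

Definition spherical_simplex (R : realType) (d : nat) (T : {fset wpoint R d}) :
    set 'rV[R]_d.+1 :=
  [set (enorm y)^-1 *: y | y in convex_hull_loc T]%classic.

(* The number of spherical d-simplices of A that satisfy P and contain x,
   a simplex being represented by the set T of its d + 1 weighted points. *)
Definition cover_count (R : realType) (d : nat) (A : {fset wpoint R d})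
    (P : {fset wpoint R d} -> Prop) (x : 'rV[R]_d.+1) : nat :=
  #|` [fset T in fpowerset A |
        (#|` T| == d.+1) && `[< P T /\ spherical_simplex T x >]]|.

Definition off_great_spheres (R : realType) (d : nat) (A : {fset wpoint R d})
    (x : 'rV[R]_d.+1) : Prop :=
  forall T : {fset wpoint R d}, T `<=` A -> #|` T| = d ->
    ~ exists u : 'rV[R]_d.+1,
        [/\ u != 0, great_sphere u x
          & forall p, p \in T -> great_sphere u (loc p)].

(* Main.v *)
(* Scale each hyperplane to dot u y = 1. A simplex T whose cone contains x is a
   feasible basis of the linear program "minimise the sum of l subject to
   x = sum of l i *: p i, l >= 0", its hyperplane u_T is the dual solution, and
   its heft counts the points cut off by u_T, i.e. the violated dual
   constraints dot u_T (p i) <= 1. Deleting a set D of at most k points leaves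
   the origin interior to the convex hull, so the restricted program has
   exactly one optimal basis: exactly one T misses D and has all its cut-off
   points in D. Counting the pairs (D, T) with #|D| = j for each j <= k yields
   a triangular system for the numbers of bases of heft at most k, which the
   binomial coefficients solve.

   For the second part, the bases of heft at most k number
   sum_(j <= k) 'C(d + j, d). Among those that avoid a are all the bases of
   heft less than k of the set without a, which is (k-1)-balanced; they number
   sum_(j < k) 'C(d + j, d). Hence at most 'C(d + k, d) contain a. *)
Require Import Defs.
From HB Require Import structures.
From mathcomp Require Import all_boot all_order all_algebra.
From mathcomp Require Import finmap.
From mathcomp Require Import all_classical all_reals all_analysis.
From mathcomp Require Import zify ring lra.
Set Implicit Arguments.
Unset Strict Implicit.
Unset Printing Implicit Defensive.
Import Order.TTheory GRing.Theory Num.Theory.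
Import numFieldNormedType.Exports.


(** * Binomial identities and intermediate sets *)

(** For [j <= m], sort the [j]-subsets of [n + 1 + m] ordered points by the number [i] of chosen
    points before the [n + 1]-st unchosen one. The case [j = m.+1] is included because the induction
    by Pascal's rule calls on it. The identity says that the numbers ['C(n + i, i)] solve the
    triangular system of [sum_levels]. *)
Lemma bin_sum_split (n m j : nat) : j <= m.+1 ->
  'C(n.+1 + m, j) = \sum_(i < j.+1) 'C(n + i, i) * 'C(m - i, j - i).
Proof.
elim: m j => [|m IHm] j; rewrite leq_eqVlt => /predU1P[-> | lejm].
- rewrite !big_ord_recl big_ord0 /= !bin0 !bin1 /bump /=; lia.
- by case: j lejm => // _; rewrite big_ord_recl big_ord0 !bin0.
- rewrite big_ord_recr /= big1 => [|i _]; last first.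
    have ltim := ltn_ord i.
    by rewrite (@bin_small (m.+1 - i)) ?muln0 //; lia.
  by rewrite add0n subnn bin0 muln1 addSnnS.
case: j lejm => [_|j lejm]; first by rewrite big_ord_recl big_ord0 !bin0.
have [le1 le2] : j.+1 <= m.+1 /\ j <= m.+1 by lia.
rewrite addnS binS !IHm //.
rewrite [RHS]big_ord_recr [X in X + _]big_ord_recr /=.
rewrite !subnn !bin0 addnAC; congr (_ + _); rewrite -big_split /=.
apply: eq_bigr => i _; rewrite -mulnDr; congr (_ * _).
have leij : i <= j by rewrite -ltnS ltn_ord.
by rewrite !subSn ?binS //; lia.
Qed.

(** Adding [A] is a bijection from the [(j - #|A|)]-subsets of [B :\: A]. The conditional is needed
    because truncated subtraction would give 1 instead of 0 when [j < #|A|]. *)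
Lemma card_between (J : finType) (A B : {set J}) (j : nat) : A \subset B ->
  #|[set D : {set J} | [&& A \subset D, D \subset B & #|D| == j]]| =
  if #|A| <= j then 'C(#|B| - #|A|, j - #|A|) else 0.
Proof.
move=> AB; case: leqP => [leAj|ltjA]; last first.
  apply: eq_card0 => D; rewrite !inE; apply/negP => /and3P[AD _ /eqP Dj].
  by have := subset_leq_card AD; lia.
have -> : #|B| - #|A| = #|B :\: A| by rewrite cardsD (finset.setIidPr AB).
rewrite -cards_draws.
rewrite -[RHS](card_in_imset (f := fun D : {set J} => D :|: A)) => [|D D'].
  apply: eq_card => D; rewrite inE; apply/and3P/imsetP => [[AD DB /eqP Dj]|].
    exists (D :\: A).
      by rewrite inE finset.setSD //= cardsD (finset.setIidPr AD) Dj.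
    rewrite finset.setUC finset.setDE finset.setUIr finset.setUCr finset.setIT.
    by apply/esym/finset.setUidPr.
  case=> E; rewrite inE subsetD => /andP[/andP[EB EA] /eqP Ej] ->.
  rewrite finset.subsetUr finset.subUset EB AB; split=> //.
  by rewrite cardsU Ej finset.disjoint_setI0 // cards0; apply/eqP; lia.
rewrite !inE !subsetD => /andP[/andP[_ DA] _] /andP[/andP[_ DA'] _] eqU.
have : (D :|: A) :\: A = (D' :|: A) :\: A by rewrite eqU.
rewrite !finset.setDUl finset.setDv !finset.setU0.
by rewrite (finset.setDidPl DA) (finset.setDidPl DA').
Qed.

(** * Counting a set family by the sizes of attached sets *)

Section LevelCount.
Variables (I : finType) (S : {set I}) (n k : nat).
Variables (F : {set {set I}}) (sep : {set I} -> {set I}).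
Hypothesis cardF : forall T, T \in F -> #|T| = n.+1.
Hypothesis subF : forall T, T \in F -> T \subset S.
Hypothesis sepF : forall T, T \in F -> sep T \subset S :\: T.
Hypothesis uniqF : forall D : {set I}, D \subset S -> #|D| <= k ->
  #|[set T in F | (sep T \subset D) && [disjoint T & D]]| = 1.

Let exF (D : {set I}) : D \subset S -> #|D| <= k ->
  exists2 T : {set I}, T \in F & (sep T \subset D) && [disjoint T & D].
Proof.
move=> DS Dk; have /eqP/cards1P[T TE] := uniqF DS Dk.
by have := set11 T; rewrite -TE inE => /andP[]; exists T.
Qed.

(* Both sides count the pairs (D, T) where D has j elements, contains sep T
   and misses T. *)
Lemma sum_levels (j : nat) : j <= k ->
  'C(#|S|, j) = \sum_(i < j.+1)
     #|[set T in F | #|sep T| == i]| * 'C(#|S| - n.+1 - i, j - i).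
Proof.
move=> lejk; rewrite -cards_draws -sum1_card.
transitivity (\sum_(D in [set D : {set I} | D \subset S & #|D| == j])
   \sum_(T in F) (sep T \subset D) && [disjoint T & D] : nat).
  apply: eq_bigr => D; rewrite inE => /andP[DS /eqP Dj].
  rewrite -[1](uniqF DS) ?Dj // -sum1_card big_mkcond /= [RHS]big_mkcond /=.
  by apply: eq_bigr => T _; rewrite inE; case: (T \in F) => //=; case: ifP.
rewrite exchange_big /=.
transitivity (\sum_(T in F) if #|sep T| <= j
     then 'C(#|S| - n.+1 - #|sep T|, j - #|sep T|) else 0).
  (* For fixed [T], the admissible [D] are the [j]-sets between [sep T] and [S :\: T]. *)
  apply: eq_bigr => T TF.
  have -> : #|S| - n.+1 = #|S :\: T|.
    by rewrite cardsD (finset.setIidPr (subF TF)) (cardF TF).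
  rewrite -card_between ?sepF //.
  rewrite -sum1_card big_mkcond /= [RHS]big_mkcond /=; apply: eq_bigr => D _.
  rewrite !inE subsetD disjoint_sym.
  by case: (sep T \subset D); case: (D \subset S); case: (#|D| == j);
    case: [disjoint _ & _].
rewrite -big_mkcondr.
rewrite (partition_big (fun T => inord #|sep T| : 'I_j.+1) xpredT) //=.
apply: eq_bigr => i _; rewrite -sum_nat_const.
have vi T : (#|sep T| <= j) && (inord #|sep T| == i) = (#|sep T| == i).
  apply/andP/eqP => [[sj /eqP <-]|->]; first by rewrite inordK.
  by rewrite -ltnS ltn_ord inord_val.
apply: eq_big => [T|T /andP[/andP[TF sj] /eqP <-]].
  by rewrite inE -andbA vi.
by rewrite inordK.
Qed.

(** In the equation of [sum_levels] the last unknown has coefficient 1, so strong induction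
    determines it; [bin_sum_split] is the same equation for the binomials. *)
Theorem card_level (j : nat) : j <= k ->
  #|[set T in F | #|sep T| == j]| = 'C(n + j, j).
Proof.
elim/ltn_ind: j => j IHj lejk.
(* The minimum is taken because [j <= #|S|] is not known yet. The member of [F] that misses [D] has
   [n.+1] points, so [S] has room for [n.+1 + #|D|] points, which forces [#|D| = j]. *)
have [D DS Dj] : exists2 D : {set I}, D \subset S & #|D| = minn j #|S|.
  have : minn j #|S| <= #|S| by rewrite geq_minr.
  case/card_geqP => s [us <- /fintype.subsetP sS]; exists [set x in s].
    by apply/fintype.subsetP => x; rewrite inE => /(fintype.subsetP sS).
  by rewrite cardsE; apply/card_uniqP.
have [|T TF /andP[_ TD]] := exF DS; first by rewrite Dj; lia.
have leS : n.+1 + #|D| <= #|S|.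
  rewrite -(cardsID T S) (finset.setIidPr (subF TF)) (cardF TF) leq_add2l.
  by apply: subset_leq_card; rewrite subsetD DS disjoint_sym.
have jS : n.+1 + j <= #|S| by lia.
have := @bin_sum_split n (#|S| - n.+1) j; rewrite subnKC; last by lia.
rewrite (sum_levels lejk) !big_ord_recr /= !subnn !bin0 !muln1.
have -> : \sum_(i < j) #|[set T in F | #|sep T| == i]| *
       'C(#|S| - n.+1 - i, j - i) =
   \sum_(i < j) 'C(n + i, i) * 'C(#|S| - n.+1 - i, j - i).
  by apply: eq_bigr => i _; rewrite IHj //; have := ltn_ord i; lia.
by move=> E; apply: (addnI (E _)); lia.
Qed.

End LevelCount.

Local Open Scope ring_scope.

(** * The Euclidean inner product *)

Section Dot.
Variables (R : realType) (n : nat).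
Implicit Types u v w : 'rV[R]_n.

Lemma dotC u v : dot u v = dot v u.
Proof. by apply: eq_bigr => i _; rewrite mulrC. Qed.

Lemma dotDr u v w : dot u (v + w) = dot u v + dot u w.
Proof. by rewrite -big_split; apply: eq_bigr => i _; rewrite mxE mulrDr. Qed.

Lemma dotZr u (a : R) v : dot u (a *: v) = a * dot u v.
Proof. by rewrite mulr_sumr; apply: eq_bigr => i _; rewrite mxE mulrCA. Qed.

Lemma dotNr u v : dot u (- v) = - dot u v.
Proof. by rewrite -scaleN1r dotZr mulN1r. Qed.

Lemma dotBr u v w : dot u (v - w) = dot u v - dot u w.
Proof. by rewrite dotDr dotNr. Qed.

Lemma dot0r u : dot u 0 = 0.
Proof. by rewrite -(scale0r 0) dotZr mul0r. Qed.

Lemma dotZl (a : R) u v : dot (a *: u) v = a * dot u v.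
Proof. by rewrite dotC dotZr dotC. Qed.

Lemma dotBl u v w : dot (u - v) w = dot u w - dot v w.
Proof. by rewrite dotC dotBr !(dotC w). Qed.

Lemma dot0l u : dot 0 u = 0.
Proof. by rewrite dotC dot0r. Qed.

Lemma dot_sumr (J : Type) (s : seq J) (P : pred J) u (f : J -> 'rV[R]_n) :
  dot u (\sum_(j <- s | P j) f j) = \sum_(j <- s | P j) dot u (f j).
Proof.
by apply: (big_morph (dot u)) => [v w|]; rewrite ?dotDr ?dot0r.
Qed.

Lemma dotE u v : dot u v = (u *m v^T) 0 0.
Proof. by rewrite mxE; apply: eq_bigr => i _; rewrite mxE. Qed.

Lemma dot_ge0 u : 0 <= dot u u.
Proof. by apply: sumr_ge0 => i _; rewrite -expr2 sqr_ge0. Qed.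

Lemma dot_eq0 u : dot u u = 0 -> u = 0.
Proof.
move=> /eqP; rewrite psumr_eq0 => [/allP u0|i _]; last first.
  by rewrite -expr2 sqr_ge0.
apply/rowP => i; rewrite mxE; apply/eqP.
by have := u0 i (mem_index_enum _); rewrite mulf_eq0 orbb.
Qed.

End Dot.

(** * Finitely generated cones: Farkas and Caratheodory *)

Section Cone.
Variables (R : realType) (n : nat) (I : finType).
Implicit Types (p q : I -> 'rV[R]_n) (S T : {set I}) (x u : 'rV[R]_n).

Definition cone p S : set 'rV[R]_n :=
  [set x | exists2 l : I -> R, forall i, i \in S -> 0 <= l i
                             & x = \sum_(i in S) l i *: p i]%classic.

(* Fourier-Motzkin elimination: if the functional u found for the tail of the
   list is positive on the head q i, project everything along q i onto the
   kernel of u. *)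
Lemma farkas_seq (s : seq I) q x : uniq s ->
  (exists2 l : I -> R, forall i, 0 <= l i & x = \sum_(i <- s) l i *: q i) \/
  (exists2 u, {in s, forall i, dot u (q i) <= 0} & 0 < dot u x).
Proof.
elim: s q x => [|i s IHs] q x /=.
  move=> _; have [->|x0] := eqVneq x 0.
    by left; exists (fun=> 0) => //; rewrite big_nil.
  right; exists x => //; rewrite lt_neqAle dot_ge0 andbT eq_sym.
  by apply: contra_neq x0 => /dot_eq0.
move=> /andP[iNs us].
have [[l l0 ->]|[u us0 ux]] := IHs q x us.
  left; exists (fun j => if j == i then 0 else l j) => [j|].
    by case: ifP.
  rewrite big_cons eqxx scale0r add0r; apply: eq_big_seq => j js.
  by case: eqP => // ji; rewrite -ji js in iNs.
have [ui|ui] := leP (dot u (q i)) 0.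
  by right; exists u => // j; rewrite inE => /predU1P[->|/us0].
pose pr y := y - (dot u y / dot u (q i)) *: q i.
have [[l l0 xE]|[v vs0 vx]] := IHs (fun j => pr (q j)) (pr x) us.
  (* The coefficient of [q i] makes up for the projections; it is nonnegative because [u] is
     positive on [q i] and [x] and at most 0 on the tail. *)
  left; exists (fun j => if j == i then
      dot u x / dot u (q i) - \sum_(j <- s) l j * (dot u (q j) / dot u (q i))
      else l j) => [j|].
    case: ifP => // _; rewrite subr_ge0; apply: (@le_trans _ _ 0).
      rewrite big_seq; apply: sumr_le0 => h hs; rewrite mulr_ge0_le0 //.
      by rewrite mulr_le0_ge0 ?us0 // invr_ge0 ltW.
    by rewrite divr_ge0 // ltW.
  rewrite big_cons eqxx (@eq_big_seq _ _ _ _ s _ (fun j => l j *: q j));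
    last first.
    by move=> j js; case: eqP => // ji; rewrite -ji js in iNs.
  rewrite -[LHS](subrK ((dot u x / dot u (q i)) *: q i)) -/(pr x).
  have -> : pr x = \sum_(j <- s) l j *: q j -
      (\sum_(j <- s) l j * (dot u (q j) / dot u (q i))) *: q i.
    rewrite xE scaler_suml -sumrB; apply: eq_bigr => j _.
    by rewrite scalerBr scalerA.
  by rewrite scalerBl addrC addrA [RHS]addrAC.
(* This functional is [v] composed with the projection [pr]; it vanishes on [q i]. *)
right; exists (v - (dot v (q i) / dot u (q i)) *: u).
  move=> j; rewrite inE dotBl dotZl => /predU1P[->|/vs0].
    by rewrite divfK ?gt_eqF // subrr.
  rewrite /pr dotBr dotZr; congr (_ <= 0).
  by field; rewrite gt_eqF.
move: vx; rewrite /pr dotBr dotZr dotBl dotZl; congr (0 < _).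
by field; rewrite gt_eqF.
Qed.

Lemma farkas p S x : ~ cone p S x ->
  exists2 u, {in S, forall i, dot u (p i) <= 0} & 0 < dot u x.
Proof.
move=> xS; have [[l l0 xE]|[u uS ux]] := farkas_seq p x (enum_uniq S).
  by case: xS; exists l => //; rewrite xE big_enum.
by exists u => // i iS; apply: uS; rewrite mem_enum.
Qed.

Definition rows p T : 'M[R]_(#|T|, n) := \matrix_j p (enum_val j).

Lemma sum_rows p T (l : I -> R) :
  \sum_(i in T) l i *: p i = (\row_j l (enum_val j)) *m rows p T.
Proof.
rewrite mulmx_sum_row big_enum_val; apply: eq_bigr => j _.
by rewrite rowK mxE.
Qed.

Lemma row_of_coefs T (v : 'rV[R]_#|T|) : exists l : I -> R,
  v = \row_j l (enum_val j).
Proof.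
have [[i iT]|T0] := pselect (exists i, i \in T).
  exists (fun j => v 0 (enum_rank_in iT j)); apply/rowP => j.
  by rewrite mxE enum_valK_in.
exists (fun=> 0); apply/rowP => j; case: T0; exists (enum_val j).
exact: enum_valP.
Qed.

Definition independent p T := forall l : I -> R,
  \sum_(i in T) l i *: p i = 0 -> {in T, forall i, l i = 0}.

Lemma independent_row_free p T : independent p T -> row_free (rows p T).
Proof.
move=> iT; rewrite -kermx_eq0; apply/eqP/row_matrixP => j; rewrite row0.
have [l lE] := row_of_coefs (row j (kermx (rows p T))).
have := sum_rows p T l; rewrite -lE -row_mul mulmx_ker row0 => /iT l0.
by rewrite lE; apply/rowP => h; rewrite !mxE l0 // enum_valP.
Qed.

Lemma dependent_card p T : (n < #|T|)%N -> exists2 l : I -> R,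
  \sum_(i in T) l i *: p i = 0 & exists2 i, i \in T & l i != 0.
Proof.
move=> nT.
have : ~ independent p T.
  move=> /independent_row_free; rewrite -row_leq_rank => /leq_trans.
  by move=> /(_ _ (rank_leq_col _)); rewrite leqNgt nT.
move=> /existsNP[l /not_implyP[l0 /existsNP[i /not_implyP[iT /eqP li]]]].
by exists l => //; exists i.
Qed.

Lemma independent_span p T y : independent p T -> #|T| = n ->
  exists l : I -> R, y = \sum_(i in T) l i *: p i.
Proof.
move=> /independent_row_free fT Tn.
have : row_full (rows p T) by rewrite /row_full -{2}Tn.
move=> fuT; have [l lE] := row_of_coefs (y *m pinvmx (rows p T)).
by exists l; rewrite sum_rows -lE mulmxKpV // submx_full.
Qed.

(** Independent rows have a right inverse, so the system with right-hand side 1 is solvable. *)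
Lemma independent_hyperplane p T : independent p T ->
  exists u, {in T, forall i, dot u (p i) = 1}.
Proof.
move=> /independent_row_free fT.
exists (pinvmx (rows p T) *m const_mx 1)^T => i iT.
rewrite dotC dotE trmxK.
have -> : p i = row (enum_rank_in iT i) (rows p T).
  by rewrite rowK enum_rankK_in.
by rewrite -row_mul mulmxA mulmxVp // mul1mx !mxE.
Qed.

Lemma orthogonal_exists p T : (#|T| < n)%N ->
  exists2 u, u != 0 & {in T, forall i, dot u (p i) = 0}.
Proof.
move=> Tn; have : kermx (rows p T)^T != 0.
  rewrite kermx_eq0 -row_leq_rank -ltnNge mxrank_tr.
  exact: leq_ltn_trans (rank_leq_row _) Tn.
case/rowV0Pn => u /sub_kermxP uT u0; exists u => // i iT.
have -> : p i = row (enum_rank_in iT i) (rows p T).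
  by rewrite rowK enum_rankK_in.
by rewrite dotC dotE -row_mul -[_ *m _]trmxK trmx_mul trmxK uT trmx0 !mxE.
Qed.

(** The minimum ratio rule of the simplex method: [t] is the least [l i / c i] over positive [c i],
    the longest step that keeps [l - t * c] nonnegative. *)
Lemma ratio_test T (l c : I -> R) i0 : {in T, forall i, 0 <= l i} ->
  i0 \in T -> 0 < c i0 ->
  exists2 t, 0 <= t & {in T, forall i, 0 <= l i - t * c i} /\
    exists2 i, i \in T & 0 < c i /\ l i = t * c i.
Proof.
move=> l0 i0T ci0.
have P0 : (i0 \in T) && (0 < c i0) by rewrite i0T.
have [/= i /andP[iT ci] imin] :=
  arg_minP (P := fun i => (i \in T) && (0 < c i)) (fun i => l i / c i) P0.
exists (l i / c i); first by rewrite divr_ge0 ?l0 // ltW.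
split; last by exists i => //; rewrite divfK // gt_eqF.
move=> j jT; have [cj|cj] := leP (c j) 0.
  rewrite subr_ge0 (le_trans _ (l0 j jT)) // mulr_ge0_le0 //.
  by rewrite divr_ge0 ?l0 // ltW.
by rewrite subr_ge0 -ler_pdivlMr // imin // jT.
Qed.

(** While there are more than [n] generators, subtracting a linear dependency up to the ratio bound
    makes one coefficient vanish. *)
Lemma caratheodory p S x : cone p S x ->
  exists2 T : {set I}, T \subset S /\ (#|T| <= n)%N & cone p T x.
Proof.
have [m] := ubnP #|S|; elim: m S => // m IHm S Sm xS.
have [Sn|nS] := leqP #|S| n; first by exists S.
case: xS => l l0 xE.
suff [j jS xSj] : exists2 j, j \in S & cone p (S :\ j) x.
  have [|T [TS Tn] xT] := IHm _ _ xSj.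
    by move: Sm; rewrite (cardsD1 j) jS.
  by exists T => //; split=> //; exact: fintype.subset_trans TS (subD1set _ _).
have [c c0 [i iS ci]] := dependent_card p nS.
wlog ci0 : c c0 ci / 0 < c i.
  move=> hw; have [ci0|ci0|/eqP] := ltgtP (c i) 0; last by rewrite (negbTE ci).
    apply: (hw (fun j => - c j)); rewrite ?oppr_eq0 ?oppr_gt0 //.
    by rewrite (eq_bigr _ (fun h _ => scaleNr _ _)) sumrN c0 oppr0.
  exact: (hw c).
have [t t0 [lt [j jS [cj lj]]]] := ratio_test l0 iS ci0.
exists j => //; exists (fun h => l h - t * c h).
  by move=> h /setD1P[_ /lt].
transitivity (\sum_(h in S) (l h - t * c h) *: p h).
  rewrite (eq_bigr _ (fun h _ => scalerBl _ _ _)) sumrB -xE.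
  rewrite (eq_bigr _ (fun h _ => esym (scalerA _ _ _))) -scaler_sumr c0.
  by rewrite scaler0 subr0.
by rewrite (big_setD1 j) //= lj subrr scale0r add0r.
Qed.

End Cone.

(** * Nondegenerate linear programs and their optimal bases *)

Section LinearProgram.
Variables (R : realType) (n : nat) (I : finType) (p : I -> 'rV[R]_n).
Variable (x : 'rV[R]_n).
Implicit Types (S T D : {set I}) (u : 'rV[R]_n).

Hypothesis indep : forall T, #|T| = n -> {in T, forall i, p i != 0} ->
  independent p T.
Hypothesis simple : forall u, (#|[set i | dot u (p i) == 1%R]| <= n)%N.
Hypothesis xgen : forall T, (#|T| < n)%N -> ~ cone p T x.

(* The bases of the linear program minimising the sum of the l i subject to
   x = sum of l i *: p i and l >= 0; its dual maximises dot u x subject to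
   dot u (p i) <= 1. *)
Definition feasible T : Prop :=
  [/\ #|T| = n, exists u, {in T, forall i, dot u (p i) = 1} & cone p T x].

(** The 0 is a default for sets without such a normal; for a feasible [T] the normal exists, and
    [normal_unique] shows that it is the only one. *)
Definition basis_normal T : 'rV[R]_n :=
  xget 0 [set u | {in T, forall i, dot u (p i) = 1}]%classic.

Definition cut_off T : {set I} := [set i | 1 < dot (basis_normal T) (p i)].

Lemma basis_normalP T : feasible T ->
  {in T, forall i, dot (basis_normal T) (p i) = 1}.
Proof.
by case=> _ [u uT] _; rewrite /basis_normal; case: xgetP => // /(_ u).
Qed.

Lemma basis_neq0 T : feasible T -> {in T, forall i, p i != 0}.
Proof.
move=> /basis_normalP uT i /uT; apply: contra_eqN => /eqP->.
by rewrite dot0r eq_sym oner_neq0.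
Qed.

Lemma basis_independent T : feasible T -> independent p T.
Proof. by move=> bT; apply: indep (basis_neq0 bT); case: bT. Qed.

(** The difference of two normals lies in the span of [T] and is orthogonal to it, hence to
    itself. *)
Lemma normal_unique T u : feasible T -> {in T, forall i, dot u (p i) = 1} ->
  u = basis_normal T.
Proof.
move=> bT uT; have [l lE] : exists l : I -> R,
    u - basis_normal T = \sum_(i in T) l i *: p i.
  by apply: independent_span (basis_independent bT) _; case: bT.
apply/eqP; rewrite -subr_eq0; apply/eqP/dot_eq0.
rewrite {2}lE dot_sumr big1 // => i iT.
by rewrite dotZr dotBl uT // basis_normalP // subrr mulr0.
Qed.

Lemma cut_off_disjoint T : feasible T -> [disjoint cut_off T & T].
Proof.
move=> bT; apply/pred0P => i /=; apply/negP => /andP[].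
by rewrite inE => /[swap] iT; rewrite basis_normalP // ltxx.
Qed.

(** A zero coefficient would put [x] in a cone of fewer than [n] points, against [xgen]. *)
Lemma cone_gt0 T (l : I -> R) : #|T| = n -> {in T, forall i, 0 <= l i} ->
  x = \sum_(i in T) l i *: p i -> {in T, forall i, 0 < l i}.
Proof.
move=> Tn l0 xE i iT; rewrite lt_neqAle l0 // andbT eq_sym.
apply/eqP => li; apply: (@xgen (T :\ i)).
  by rewrite -Tn (cardsD1 i T) iT.
exists l => [j /setD1P[_]/l0//|].
by rewrite xE (big_setD1 i) //= li scale0r add0r.
Qed.

(* Weak duality with complementary slackness: both normals are optimal for
   the program restricted to S, so they coincide. *)
Lemma optimal_basis_unique S T T' : feasible T -> feasible T' ->
  T \subset S -> T' \subset S ->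
  [disjoint cut_off T & S] -> [disjoint cut_off T' & S] -> T = T'.
Proof.
have le1 (U V : {set I}) : [disjoint cut_off U & S] -> V \subset S ->
    {in V, forall i, dot (basis_normal U) (p i) <= 1}.
  move=> US VS i iV; rewrite leNgt; apply/negP => gt1.
  have iS := fintype.subsetP VS i iV.
  by have := disjointFl US iS; rewrite inE gt1.
have val (U : {set I}) (l : I -> R) : feasible U ->
    x = \sum_(i in U) l i *: p i ->
    dot (basis_normal U) x = \sum_(i in U) l i.
  move=> bU ->; rewrite dot_sumr; apply: eq_bigr => i iU.
  by rewrite dotZr basis_normalP // mulr1.
have le (U V : {set I}) : feasible V -> V \subset S ->
    [disjoint cut_off U & S] ->
    dot (basis_normal U) x <= dot (basis_normal V) x.
  move=> bV VS US; have [_ _ [l l0 xE]] := bV.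
  rewrite (val V l) // xE dot_sumr; apply: ler_sum => i iV.
  by rewrite dotZr ler_piMr ?l0 ?(le1 U V).
move=> bT bT' TS TS' cT cT'.
have eqx : dot (basis_normal T') x = dot (basis_normal T) x.
  by apply/eqP; rewrite eq_le !le.
have nE : basis_normal T' = basis_normal T.
  have [Tn _ [l l0 xE]] := bT.
  apply: normal_unique => // i iT; apply/eqP; rewrite eq_le (le1 T' T) //=.
  have l_gt0 := cone_gt0 Tn l0 xE.
  move: eqx; rewrite (val T l) // xE dot_sumr => /eqP; rewrite -subr_eq0 -sumrB.
  (* The terms [l i * (1 - dot u (p i))] are nonnegative with sum 0, so each is 0, and [l i] is
     positive. *)
  rewrite -oppr_eq0 -sumrN psumr_eq0 => [/allP/(_ i (mem_index_enum _))|j jT].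
    rewrite iT /= oppr_eq0 subr_eq0 dotZr => /eqP.
    by rewrite -[RHS]mulr1 => /(mulfI (lt0r_neq0 (l_gt0 i iT))) ->.
  by rewrite oppr_ge0 subr_le0 dotZr ler_piMr ?l0 ?(le1 T' T).
(* By [simple] a hyperplane carries at most [n] points, so a basis consists of all points on its
   hyperplane. *)
have sub (U : {set I}) : feasible U -> basis_normal U = basis_normal T ->
    U = [set i | dot (basis_normal T) (p i) == 1].
  move=> bU nU; apply/eqP; rewrite eqEcard; case: (bU) => -> _ _.
  rewrite simple andbT; apply/fintype.subsetP => i iU.
  by rewrite inE -nU basis_normalP.
by rewrite (sub T) // [RHS](sub T').
Qed.

(** By [xgen], the set from [caratheodory] has exactly [n] elements and contains no zero vector,
    which could be dropped. *)
Lemma basis_of_cone S : cone p S x ->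
  exists2 T, feasible T & T \subset S.
Proof.
move=> /caratheodory[T [TS Tn] xT]; exists T => //.
have {}Tn : #|T| = n.
  by apply/eqP; rewrite eqn_leq Tn leqNgt; apply/negP => /xgen.
have T0 : {in T, forall i, p i != 0}.
  move=> i iT; apply/eqP => pi0; apply: (@xgen (T :\ i)).
    by rewrite -Tn (cardsD1 i T) iT.
  case: xT => l l0 ->; exists l => [j /setD1P[_]/l0//|].
  by rewrite (big_setD1 i) //= pi0 scaler0 add0r.
by split=> //; exact: independent_hyperplane (indep Tn T0).
Qed.

(** A simplex pivot: [b] enters, the index found by the ratio test leaves, and with step [t] the
    objective drops by [t * (dot (basis_normal T) (p b) - 1)]. *)
Lemma basis_pivot S T b : feasible T -> T \subset S -> b \in S ->
  b \in cut_off T ->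
  exists2 T', feasible T' & T' \subset S /\
    dot (basis_normal T') x < dot (basis_normal T) x.
Proof.
move=> bT TS bS bcut; have [Tn _ [l l0 xE]] := bT.
have bT' : b \notin T.
  by rewrite (disjointFr (cut_off_disjoint bT) bcut).
have [m mE] := independent_span (p b) (basis_independent bT) Tn.
have val : dot (basis_normal T) (p b) = \sum_(i in T) m i.
  rewrite mE dot_sumr; apply: eq_bigr => i iT.
  by rewrite dotZr basis_normalP // mulr1.
(* The coefficients [m] sum to more than 1, since [b] is cut off. *)
have [i0 i0T mi0] : exists2 i, i \in T & 0 < m i.
  apply: contrapT => /forall2NP mle.
  have : \sum_(i in T) m i <= 0.
    by apply: sumr_le0 => i iT; rewrite leNgt; case: (mle i) => // /negP.
  by move: bcut; rewrite inE val; lra.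
have [t t0 [tl [i iT [mi li]]]] := ratio_test l0 i0T mi0.
(* Nondegeneracy makes the step strictly positive. *)
have t_gt0 : 0 < t.
  have := cone_gt0 Tn l0 xE iT; rewrite li.
  by rewrite pmulr_lgt0.
pose T' := b |: T :\ i.
have bTi : b \notin T :\ i by rewrite !inE negb_and bT' orbT.
have T'n : #|T'| = n.
  by rewrite cardsU1 bTi -Tn (cardsD1 i T) iT.
pose l' j := if j == b then t else l j - t * m j.
have eqT (f : I -> R -> 'rV[R]_n) : \sum_(j in T :\ i) f j (l' j) =
    \sum_(j in T :\ i) f j (l j - t * m j).
  apply: eq_bigr => j jT; rewrite /l'; case: eqP => // jb.
  by rewrite -jb jT in bTi.
have xE' : x = \sum_(j in T') l' j *: p j.
  rewrite big_setU1 //= {1}/l' eqxx (eqT (fun j a => a *: p j)).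
  transitivity (t *: p b + \sum_(h in T) (l h - t * m h) *: p h).
    rewrite (eq_bigr _ (fun h _ => scalerBl _ _ _)) sumrB -xE.
    rewrite (eq_bigr _ (fun h _ => esym (scalerA _ _ _))) -scaler_sumr -mE.
    by rewrite addrC subrK.
  by rewrite (big_setD1 i iT) /= li subrr scale0r add0r.
have l'0 : {in T', forall j, 0 <= l' j}.
  move=> j; rewrite !inE /l'; case: eqP => //= _ /andP[_]; exact: tl.
have T'0 : {in T', forall j, p j != 0}.
  move=> j; rewrite !inE => /predU1P[->|/andP[_ /(basis_neq0 bT)//]].
  apply/eqP => pb; move: bcut; rewrite inE pb dot0r.
  by rewrite ltr10.
have bT'' : feasible T'.
  by split=> //; [exact: independent_hyperplane (indep T'n T'0)|exists l'].
exists T' => //; split.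
  rewrite finset.subUset finset.sub1set bS.
  exact: fintype.subset_trans (subD1set _ _) TS.
rewrite [in ltLHS]xE' xE !dot_sumr.
have -> : \sum_(j in T') dot (basis_normal T') (l' j *: p j) =
    t + \sum_(j in T :\ i) (l j - t * m j).
  rewrite big_setU1 //= {1}/l' eqxx dotZr basis_normalP ?setU11 // mulr1.
  congr (_ + _).
  apply: eq_bigr => j jT; rewrite dotZr basis_normalP ?setU1r // mulr1 /l'.
  by case: eqP => // jb; rewrite -jb jT in bTi.
have -> : \sum_(j in T :\ i) (l j - t * m j) = \sum_(j in T) (l j - t * m j).
  by rewrite [RHS](big_setD1 i iT) /= li subrr add0r.
rewrite sumrB -mulr_sumr -val.
have -> : \sum_(j in T) dot (basis_normal T) (l j *: p j) = \sum_(j in T) l j.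
  by apply: eq_bigr => j jT; rewrite dotZr basis_normalP // mulr1.
move: bcut; rewrite inE => gt1.
have : 0 < t * (dot (basis_normal T) (p b) - 1) by rewrite mulr_gt0 // subr_gt0.
by lra.
Qed.

(** There are finitely many bases in [S]; one with least objective value admits no pivot. *)
Lemma optimal_basis_exists S : cone p S x ->
  exists2 T, feasible T & T \subset S /\ [disjoint cut_off T & S].
Proof.
move=> /basis_of_cone[T0 bT0 TS0].
have P0 : `[< feasible T0 >] && (T0 \subset S).
  by rewrite TS0 andbT; apply/asboolP.
have [/= T /andP[/asboolP bT TS] Tmin] :=
  arg_minP (P := fun T => `[< feasible T >] && (T \subset S))
    (fun T => dot (basis_normal T) x) P0.
exists T => //; split=> //; apply/pred0P => b /=; apply/negP => /andP[bc bS].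
have [T' bT' [TS' lt]] := basis_pivot bT TS bS bc.
have := Tmin T'; rewrite TS' andbT leNgt lt => /(_ _)/negP; apply=> //.
exact/asboolP.
Qed.

Definition bases : {set {set I}} := [set T | `[< feasible T >]].

(** For [T] inside [S], the two conditions on [D] together say that [T] is an optimal basis for
    [S :\: D]. This supplies [uniqF]. *)
Lemma card_optimal_bases S D : cone p (S :\: D) x -> D \subset S ->
  #|[set T in [set T in bases | T \subset S] |
      (cut_off T :&: S \subset D) && [disjoint T & D]]| = 1.
Proof.
move=> xSD DS; have [T bT [TSD cT]] := optimal_basis_exists xSD.
apply/eqP/cards1P; exists T; apply/setP => T'; rewrite !inE.
have EQ (U : {set I}) : (U \subset S) &&
    ((cut_off U :&: S \subset D) && [disjoint U & D])
    = (U \subset S :\: D) && [disjoint cut_off U & S :\: D].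
  rewrite subsetD -[[disjoint _ & S :\: D]]setI_eq0.
  rewrite finset.setIDA finset.setD_eq0.
  by rewrite -!andbA; congr (_ && _); rewrite andbC.
rewrite -andbA EQ; apply/idP/eqP => [/and3P[/asboolP bT' TS' cT']|->].
  exact: optimal_basis_unique cT' cT.
by rewrite TSD cT !andbT; apply/asboolP.
Qed.

End LinearProgram.

(** * Counting bases of balanced configurations *)

Section BalancedCount.
Variables (R : realType) (d : nat) (I : finType) (p : I -> 'rV[R]_d.+1).
Variable (x : 'rV[R]_d.+1).
Hypothesis indep : forall T : {set I}, #|T| = d.+1 ->
  {in T, forall i, p i != 0} -> independent p T.
Hypothesis simple : forall u, (#|[set i | dot u (p i) == 1%R]| <= d.+1)%N.
Hypothesis xgen : forall T : {set I}, (#|T| < d.+1)%N -> ~ cone p T x.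

(** The set [S] is a parameter so that the count also applies after the deletion of a point. *)
Lemma card_bases_level (S : {set I}) (k j : nat) :
  (forall u : 'rV[R]_d.+1, u != 0 ->
    (k < #|[set i in S | (0 < dot u (p i))%R]|)%N) ->
  (j <= k)%N ->
  #|[set T in bases p x | (T \subset S) && (#|cut_off p T :&: S| == j)]|
    = 'C(d + j, d).
Proof.
move=> bal lejk.
pose F := [set T in bases p x | T \subset S].
have bF T : T \in F -> feasible p x T /\ T \subset S.
  by rewrite !inE => /andP[/asboolP].
(* Otherwise Farkas gives a normal whose positive side meets [S] only in [D], hence in at most [k]
   points. *)
have xcone (D : {set I}) : (#|D| <= k)%N -> cone p (S :\: D) x.
  move=> Dk; apply: contrapT => /farkas[u uSD ux].
  have u0 : u != 0 by apply: contraTneq ux => ->; rewrite dot0l ltxx.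
  have := bal u u0; rewrite ltnNge => /negP; apply; apply: leq_trans Dk.
  apply: subset_leq_card; apply/fintype.subsetP => i; rewrite inE => /andP[iS].
  by apply: contraTT => iD; rewrite -leNgt uSD // inE iD.
rewrite -[RHS]bin_sub ?leq_addr // addKn.
rewrite -(@card_level I S d k F (fun T => cut_off p T :&: S)) //.
- by apply: eq_card => T; rewrite !inE andbA.
- by move=> T /bF[[]].
- by move=> T /bF[].
- move=> T /bF[bT _]; rewrite subsetD subsetIr /=.
  exact: disjointWl (subsetIl _ _) (cut_off_disjoint bT).
- by move=> D DS Dk; exact: (card_optimal_bases indep simple xgen (xcone D Dk)).
Qed.

Variable k : nat.
Hypothesis bal : forall u : 'rV[R]_d.+1, u != 0 ->
  (k < #|[set i | (0 < dot u (p i))%R]|)%N.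

Lemma card_bases_heft j : (j <= k)%N ->
  #|[set T in bases p x | #|cut_off p T| == j]| = 'C(d + j, d).
Proof.
move=> lejk; rewrite -(@card_bases_level [set: I] k j) //.
  by apply: eq_card => T; rewrite !inE finset.subsetT finset.setIT.
move=> u u0; rewrite (eq_card (B := [set i | (0 < dot u (p i))%R])) ?bal //.
by move=> i; rewrite !inE.
Qed.

(* Deleting a leaves a (k-1)-balanced set, and a basis that avoids a cuts off
   at most one point more than it does after the deletion. *)
Lemma card_bases_vertex (a : I) :
  (#|[set T in bases p x | (a \in T) && (#|cut_off p T| <= k)%N]|
    <= 'C(d + k, d))%N.
Proof.
pose W := [set T in bases p x | (a \in T) && (#|cut_off p T| <= k)%N].
pose V := [set T in bases p x |
  (T \subset [set~ a]) && (#|cut_off p T :&: [set~ a]| < k)%N].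
have cardI (m : nat) (Q : {set {set I}}) (f : {set I} -> nat) :
    #|[set T in Q | (f T < m)%N]| = (\sum_(j < m) #|[set T in Q | f T == j]|)%N.
  elim: m => [|m IHm].
    by rewrite big_ord0; apply: eq_card0 => T; rewrite inE andbF.
  rewrite big_ord_recr /= -IHm -cardsUI.
  rewrite [X in (_ + X)%N]eq_card0 ?addn0 => [|T]; last first.
    by rewrite !inE; case: (T \in Q) => //=; case: ltngtP.
  apply: eq_card => T; rewrite !inE ltnS leq_eqVlt.
  by case: (T \in Q) => //=; rewrite orbC.
have cardV : #|V| = (\sum_(j < k) 'C(d + j, d))%N.
  have -> : V = [set T in [set T in bases p x | T \subset [set~ a]] |
      (#|cut_off p T :&: [set~ a]| < k)%N].
    by apply/setP => T; rewrite !inE andbA.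
  rewrite cardI; apply: eq_bigr => j _.
  (* Without [a], each open side keeps at least [k] points; the predecessor is genuine because
     [j < k]. *)
  rewrite -(@card_bases_level [set~ a] k.-1 j); last 2 first.
  - move=> u u0; have := bal u0; rewrite (cardsD1 a).
    rewrite (eq_card (A := [set i in [set~ a] | (0 < dot u (p i))%R])
      (B := [set i | (0 < dot u (p i))%R] :\ a)) => [|i]; last by rewrite !inE.
    by case: (a \in _); have := ltn_ord j; lia.
  - by have := ltn_ord j; lia.
  by apply: eq_card => T; rewrite !inE andbA.
(* [V] and [W] are disjoint, as their members avoid or contain [a], and both consist of bases
   cutting off at most [k] points. *)
have cardVW : (#|V| + #|W| <= \sum_(j < k.+1) 'C(d + j, d))%N.
  rewrite -(eq_bigr _ (fun (j : 'I_k.+1) _ => card_bases_heft (ltn_ord j))).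
  rewrite -cardI -cardsUI [X in (_ + X)%N]eq_card0 ?addn0 => [|T]; last first.
    rewrite !inE finset.subsets_disjoint finset.setCK disjoint_sym disjoints1.
    by case: (a \in T); rewrite ?andbF.
  apply: subset_leq_card; apply/fintype.subsetP => T; rewrite !inE ltnS.
  case/orP => /and3P[-> //= _ cT].
  apply: leq_trans cT; rewrite (cardsD1 a) finset.setDE.
  by case: (a \in _); lia.
by move: cardVW; rewrite big_ord_recr cardV leq_add2l.
Qed.

End BalancedCount.

(** * Passing between finite sets and subsets of a finite type *)

Lemma free_seq_coef (F : fieldType) (V : vectType F) (K : eqType)
    (s : seq K) (f : K -> V) (c : K -> F) :
  free [seq f q | q <- s] -> \sum_(q <- s) c q *: f q = 0 ->
  {in s, forall q, c q = 0}.
Proof.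
elim: s => [//|q s IHs] /=; rewrite free_cons big_cons => /andP[fq fs] sum0.
have cq : c q = 0.
  apply: contraNeq fq => cq.
  have -> : f q = - (c q)^-1 *: \sum_(i <- s) c i *: f i.
    move/eqP: sum0; rewrite addrC addr_eq0 => /eqP->.
    by rewrite scalerN scaleNr opprK scalerA mulVf // scale1r.
  rewrite memvZ // big_seq memv_suml // => i si.
  by rewrite memvZ // memv_span // map_f.
move: sum0; rewrite cq scale0r add0r => /(IHs fs) cs j.
by rewrite inE => /predU1P[->|/cs].
Qed.

Lemma card_fset_cond (K : choiceType) (A : {fset K}) (P : pred K) :
  #|` [fset q in A | P q]%fset| = #|[set i : A | P (val i)]|.
Proof.
rewrite -(@card_fsub _ A); last by apply/fsubsetP => q; rewrite !inE => /andP[].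
by apply: eq_card => i; rewrite !inE (valP i).
Qed.

Section FsetOf.
Variables (K : choiceType) (A : {fset K}).
Implicit Type T : {set A}.

Definition fset_of T : {fset K} := [fsetval i in T]%fset.

Lemma fset_ofP T (q : K) :
  reflect (exists2 i, i \in T & q = val i) (q \in fset_of T).
Proof. by apply: (iffP (imfsetP _ _ _ _)) => -[i iT ->]; exists i. Qed.

Lemma fset_of_sub T : (fset_of T `<=` A)%fset.
Proof. by apply/fsubsetP => q /fset_ofP[i _ ->]; exact: valP. Qed.

Lemma card_fset_of T : #|` fset_of T| = #|T|.
Proof. by rewrite -(card_fsub (fset_of_sub T)) FSetK. Qed.

Lemma mem_fset_of T (i : A) : (val i \in fset_of T) = (i \in T).
Proof. by rewrite -[in RHS](FSetK T) in_fsub. Qed.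

Lemma sum_fset_of (V : zmodType) T (f : K -> V) :
  \sum_(q <- fset_of T) f q = \sum_(i in T) f (val i).
Proof.
by rewrite eq_big_imfset /= ?big_map ?big_enum // => ? ? _ _; exact: val_inj.
Qed.

Lemma card_fpowerset_cond (P : pred {fset K}) :
  #|` [fset T in fpowerset A | P T]%fset| = #|[set T | P (fset_of T)]|.
Proof.
have -> : [fset T in fpowerset A | P T]%fset =
    [fset fset_of T | T in [set T | P (fset_of T)]]%fset.
  apply/fsetP => T; rewrite !inE fpowersetE.
  apply/andP/imfsetP => /= [[TA PT]|[T']].
    by exists (fsub A T); rewrite ?inE /fset_of fsubK.
  by rewrite inE => PT ->; rewrite fset_of_sub.
rewrite card_imfset; first by rewrite -cardE.
by move=> T T' eqT; rewrite -(FSetK T) -/(fset_of T) eqT FSetK.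
Qed.

End FsetOf.

(** * From weighted points to the linear program *)

Section Transfer.
Variables (R : realType) (d k : nat) (A : {fset wpoint R d}).
Hypothesis hA : ([set` A] `<=` sphere R d `*` [set r : R | 0 <= r])%classic.
Hypotheses (hgen : generic A) (hbal : balanced k A).
Implicit Types (T : {set A}) (i : A) (u : 'rV[R]_d.+1).

Let p (i : A) := pt (val i).
(** A relation among the points is one among the locations with coefficients multiplied by the
    radii, which are nonzero here. *)
Lemma pt_independent T : #|T| = d.+1 -> {in T, forall i, p i != 0} ->
  independent p T.
Proof.
move=> Tn p0 l l0 i iT.
(* The coefficients are extended by 0 to weighted points outside [A]. *)
pose c q := if insub q is Some j then l j * (val j).2 else 0.
have cE j : c (val j) = l j * (val j).2 by rewrite /c valK.
have : c (val i) = 0.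
  apply: (@free_seq_coef R _ _ (fset_of T) (@loc R d) c).
  - by apply: hgen.1; rewrite ?fset_of_sub ?card_fset_of.
  - rewrite sum_fset_of -[RHS]l0; apply: eq_bigr => j _.
    by rewrite cE -scalerA.
  - by rewrite mem_fset_of.
rewrite cE => /eqP; rewrite mulf_eq0 => /predU1P[//|/eqP r0].
by have := p0 i iT; rewrite /p /pt r0 scale0r eqxx.
Qed.

Lemma pt_simple u : (#|[set i | dot u (p i) == 1%R]| <= d.+1)%N.
Proof.
rewrite leqNgt; apply/negP => /card_geqP[s [us sn sS]].
have Tn : #|[set i in s]| = d.+2 by rewrite cardsE -sn; apply/card_uniqP.
have := hgen.2 (fset_of [set i in s]) (fset_of_sub _).
rewrite card_fset_of => /(_ Tn); apply.
exists u, 1; split; last first.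
  by move=> q /fset_ofP[i + ->]; rewrite inE => /sS; rewrite inE => /eqP.
(* The normal is nonzero because it has product 1 with some point. *)
have /card_gt0P[i] : (0 < #|[set i in s]|)%N by rewrite Tn.
rewrite inE => /sS; rewrite inE; apply: contraTneq => ->.
by rewrite dot0l eq_sym oner_eq0.
Qed.

Lemma pt_balanced u : u != 0 -> (k < #|[set i | (0 < dot u (p i))%R]|)%N.
Proof. by move=> /hbal[]; rewrite card_fset_cond. Qed.

(** At most [d] points would all lie on one hyperplane through the origin, leaving its sides
    empty. *)
Lemma card_ge_dim : (d < #|{: A}|)%N.
Proof.
rewrite ltnNge; apply/negP => Ad.
have [|u u0 uA] := @orthogonal_exists R d.+1 _ p [set: A].
  by rewrite cardsT.
have := pt_balanced u0; rewrite (eq_card0 (A := [set i | _])) // => i.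
by rewrite !inE uA ?inE // ltxx.
Qed.

(** [off_great_spheres] speaks of exactly [d] points, so [T] is padded to that size; a great sphere
    through the padded set also contains [x]. *)
Lemma cone_off_great_spheres x T : sphere R d x -> off_great_spheres A x ->
  (#|T| < d.+1)%N -> ~ cone p T x.
Proof.
move=> Sx xoff Td xT.
have : (d - #|T| <= #|~: T|)%N.
  by rewrite leq_subLR cardsC ltnW // card_ge_dim.
move=> /card_geqP[s [us sn sS]].
pose T' := T :|: [set i in s].
have Tn : #|T'| = d.
  rewrite cardsU cardsE (card_uniqP us) sn.
  have -> : T :&: [set i in s] = finset.set0.
    apply/setP => i; rewrite !inE; apply/negP => /andP[iT /sS].
    by rewrite inE iT.
  by rewrite cards0; lia.
have [|u u0 uT] := @orthogonal_exists R d.+1 _ (fun i : A => loc (val i)) T'.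
  by rewrite Tn.
apply: (xoff (fset_of T')); rewrite ?fset_of_sub ?card_fset_of //.
exists u; split=> //.
  split=> //; rewrite /hyperplane /=; case: xT => l _ ->.
  rewrite dot_sumr big1 // => i iT.
  by rewrite dotZr dotZr uT ?mulr0 // inE iT.
move=> q /fset_ofP[i iT ->]; split; last exact: uT.
by have [] := hA (valP i).
Qed.

(** Dividing the normal by the nonzero offset [c] turns both orientations of separation into the one
    inequality [1 < dot u (p i)]. *)
Lemma has_heftP T j : #|T| = d.+1 -> has_heft A (fset_of T) j <->
  exists2 u, {in T, forall i, dot u (p i) = 1} &
    #|[set i | (1 < dot u (p i))%R]| = j.
Proof.
move=> Tn; have cardE u c :
    (forall q, q \in fset_of T -> hyperplane u c (pt q)) -> c != 0 ->
    #|` [fset b in (A `\` fset_of T) | separates u c 0 (pt b)]%fset| =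
    #|[set i | (1 < dot (c^-1 *: u) (p i))%R]|.
  move=> uT c0.
  rewrite -(@card_fsub _ A); last first.
    by apply/fsubsetP => q; rewrite !inE => /andP[/andP[]].
  apply: eq_card => i; rewrite !inE (valP i) ?mem_fset_of andbT dotZl.
  rewrite /separates dot0r.
  have -> : (0 < c) && (c < dot u (pt (val i))) ||
      (dot u (pt (val i)) < c) && (c < 0) = (1 < c^-1 * dot u (p i)).
    have [cneg|cpos|/eqP] := ltgtP c 0; last by rewrite (negbTE c0).
      by rewrite andbT mulrC ltr_ndivlMr // mul1r.
    by rewrite andbF orbF mulrC ltr_pdivlMr // mul1r.
  case iT: (i \in T) => //=; apply/esym.
  have /uT : val i \in fset_of T by rewrite mem_fset_of.
  by rewrite /hyperplane /= => uc; rewrite /p uc mulVf // ltxx.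
split=> [[u [c [u0 uT c0 <-]]]|[u uT <-]].
  have {}c0 : c != 0.
    by apply/eqP => c0'; apply: c0; rewrite /hyperplane /= dot0r c0'.
  exists (c^-1 *: u); last by rewrite cardE.
  move=> i iT; rewrite dotZl.
  have /uT : val i \in fset_of T by rewrite mem_fset_of.
  by rewrite /hyperplane /= => ->; rewrite mulVf.
have uT' q : q \in fset_of T -> hyperplane u 1 (pt q).
  by move=> /fset_ofP[i iT ->]; exact: uT.
exists u, 1; split=> //; last by rewrite cardE // invr1 scale1r.
  have /card_gt0P[i iT] : (0 < #|T|)%N by rewrite Tn.
  have := uT i iT; apply: contra_eqN => /eqP->.
  by rewrite dot0l eq_sym oner_eq0.
by rewrite /hyperplane /= dot0r => /esym/eqP; rewrite oner_eq0.
Qed.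

(** Positive rescaling of the generators by their radii, or of the whole combination, leaves the
    cone unchanged. *)
Lemma spherical_simplexP x T : sphere R d x ->
  {in T, forall i, (val i).2 != 0} ->
  spherical_simplex (fset_of T) x <-> cone p T x.
Proof.
move=> Sx r0.
have r_gt0 i : i \in T -> 0 < (val i).2.
  move=> iT; rewrite lt_neqAle eq_sym r0 //=.
  by have [_] := hA (valP i).
split=> [[y [w [w0 _ ->]] <-]|[l l0 xE]].
  rewrite sum_fset_of; set e := enorm _.
  exists (fun i => e^-1 * w (val i) / (val i).2) => [i iT|].
    rewrite !mulr_ge0 ?invr_ge0 ?sqrtr_ge0 ?(ltW (r_gt0 i iT)) //.
    by rewrite w0 // mem_fset_of.
  rewrite scaler_sumr; apply: eq_bigr => i iT.
  by rewrite !scalerA divfK // r0.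
pose c q := if insub q is Some j then l j * (val j).2 else 0.
have cE j : c (val j) = l j * (val j).2 by rewrite /c valK.
pose s := \sum_(i in T) c (val i).
have c0 i : i \in T -> 0 <= c (val i).
  by move=> iT; rewrite cE mulr_ge0 ?l0 ?(ltW (r_gt0 i iT)).
have xE' : x = \sum_(i in T) c (val i) *: loc (val i).
  by rewrite xE; apply: eq_bigr => i _; rewrite cE -scalerA.
have s_gt0 : 0 < s.
  rewrite lt_neqAle sumr_ge0 // andbT eq_sym; apply/eqP => /eqP.
  rewrite psumr_eq0 // => /allP s0.
  have x0 : x = 0.
    rewrite xE' big1 // => i iT; have := s0 i (mem_index_enum _).
    by rewrite iT => /eqP->; rewrite scale0r.
  move: Sx; rewrite x0 /sphere /= /enorm dot0r sqrtr0 => /eqP.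
  by rewrite eq_sym oner_eq0.
(* Dividing by the total weight [s] gives a convex combination, of norm [s^-1] because [x] is a unit
   vector. *)
exists (s^-1 *: x).
  exists (fun q => s^-1 * c q); split.
  - by move=> q /fset_ofP[i iT ->]; rewrite mulr_ge0 ?c0 // invr_ge0 ltW.
  - by rewrite sum_fset_of -mulr_sumr mulVf // gt_eqF.
  - rewrite sum_fset_of xE' scaler_sumr.
    by apply: eq_bigr => i _; rewrite scalerA.
have -> : enorm (s^-1 *: x) = s^-1.
  rewrite /enorm dotZr dotZl mulrA -expr2 sqrtrM ?sqr_ge0 // sqrtr_sqr.
  rewrite gtr0_norm ?invr_gt0 //.
  by move: Sx; rewrite /sphere /= /enorm => ->; rewrite mulr1.
by rewrite invrK scalerA divff ?scale1r // gt_eqF.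
Qed.

(* A point of radius 0 lies on no hyperplane that misses the origin, so a
   simplex with a heft has only points of positive radius. *)
Lemma heft_simplexP x T j : sphere R d x -> #|T| = d.+1 ->
  has_heft A (fset_of T) j /\ spherical_simplex (fset_of T) x <->
  feasible p x T /\ #|cut_off p T| = j.
Proof.
move=> Sx Tn; have r0 u : {in T, forall i, dot u (p i) = 1} ->
    {in T, forall i, (val i).2 != 0}.
  move=> uT i /uT; apply: contra_eqN => /eqP r0.
  by rewrite /p /pt r0 scale0r dot0r eq_sym oner_eq0.
rewrite has_heftP //; split=> [[[u uT <-]]|[fT <-]].
  rewrite spherical_simplexP //; last exact: r0 uT.
  move=> xT; have fT : feasible p x T by split=> //; exists u.
  by split=> //; rewrite /cut_off -(normal_unique pt_independent fT uT).
have [_ [u uT] xT] := fT; split; last first.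
  by rewrite spherical_simplexP //; exact: r0 uT.
by exists (basis_normal p T) => //; exact: basis_normalP fT.
Qed.

Lemma card_fset_cover x (P : {fset wpoint R d} -> Prop) (Q : pred {set A}) :
  (forall T, #|T| = d.+1 ->
    P (fset_of T) /\ spherical_simplex (fset_of T) x <->
    feasible p x T /\ Q T) ->
  cover_count A P x = #|[set T in bases p x | Q T]|.
Proof.
move=> PQ; rewrite /cover_count card_fpowerset_cond.
apply: eq_card => T; rewrite !inE card_fset_of.
apply/andP/andP => [[/eqP Tn /asboolP/(PQ T Tn)[fT QT]]|[/asboolP fT QT]].
  by split=> //; apply/asboolP.
have [Tn _ _] := fT; split; first exact/eqP.
by apply/asboolP/(PQ T Tn).
Qed.

End Transfer.

(** * The two covering numbers *)

Local Open Scope classical_set_scope.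
Local Open Scope ring_scope.

Theorem theorem10 (R : realType) (d k : nat) (hd : (1 <= d)%N)
    (A : {fset ('rV[R]_d.+1 * R)})
    (hA : [set` A] `<=` sphere R d `*` [set r : R | 0 <= r])
    (hgen : generic A) (hbal : balanced k A)
    (a : 'rV[R]_d.+1 * R) (ha : a \in A) :
  (forall x : 'rV[R]_d.+1, sphere R d x -> off_great_spheres A x ->
     cover_count A (fun T => has_heft A T k) x = 'C(d + k, d)) /\
  (\forall U \near powerset_filter_from (nbhs (loc a)),
     forall x : 'rV[R]_d.+1, U x -> sphere R d x -> off_great_spheres A x ->
       (cover_count A
          (fun T => a \in T /\ exists2 j, (j <= k)%N & has_heft A T j) x
        <= 'C(d + k, d))%N).
Proof.
split=> [x Sx xoff|].
  rewrite -(@card_bases_heft R d _ (fun i : A => pt (val i)) x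
    (pt_independent hgen) (pt_simple hgen)
    (fun T => @cone_off_great_spheres _ _ _ _ hA hbal x T Sx xoff)
    k (pt_balanced hbal) k (leqnn k)).
  apply: card_fset_cover => T Tn; rewrite heft_simplexP //.
  by split=> -[fT /eqP].
(* The bound is shown at every admissible [x], hence on each neighborhood of [loc a]. *)
apply: nearW => U x _ Sx xoff; apply: leq_trans (card_bases_vertex
    (pt_independent hgen) (pt_simple hgen)
    (fun T => @cone_off_great_spheres _ _ _ _ hA hbal x T Sx xoff)
    (pt_balanced hbal) [` ha]%fset).
rewrite (@card_fset_cover _ _ _ x _ (fun T =>
  ([` ha]%fset \in T) && (#|cut_off (fun i : A => pt (val i)) T| <= k)%N)) //.
move=> T Tn; rewrite (mem_fset_of T [` ha]%fset).
split=> [[[aT [j jk hj]] xT]|[fT /andP[aT ck]]].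
  have [fT cj] := (heft_simplexP hA hgen j Sx Tn).1 (conj hj xT).
  by split=> //; rewrite aT cj.
have [hj xT] := (heft_simplexP hA hgen _ Sx Tn).2 (conj fT erefl).
by do 2!split=> //; exists #|cut_off (fun i : A => pt (val i)) T|.
Qed.
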